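(* Let $C$ be a binary linear $[n,k,d]$ code containing the all-one vector $\mathbf{1}_n$, let $d^{\perp}$ be the minimum distance of its dual code $C^{\perp}$, and let $t\in\mathbb{N}$. (1) If $C$ satisfies the AM-condition for $t$ with $d^{\perp}-t=4$, then $(d^{\perp},t)=(6,2)$ or $(d^{\perp},t)=(8,4)$. (2) If $C$ satisfies the AM-condition for $t$ with $d^{\perp}-t=5$, then $(d^{\perp},t)=(6,1)$, $(8,3)$, or $(10,5)$.
   Context: $\mathbb{N}$ denotes the set of positive integers. A binary linear code $C$ of length $n$ is a subspace of $\mathbb{F}_2^n$. The weight $\mathrm{wt}(x)$ of $x\in\mathbb{F}_2^n$ is the number of its nonzero coordinates. An $[n,k,d]$ code is a linear code of length $n$, dimension $k$ and minimum distance $d=\min\{\mathrm{wt}(x)\mid x\in C,\ x\neq 0\}$. The dual code is $C^{\perp}=\{y\in\mathbb{F}_2^n\mid \sum_{i=1}^n x_iy_i=0 \text{ for all } x\in C\}$, and it is an $[n,n-k,d^{\perp}]$ code, where $d^{\perp}$ is its minimum distance. Put $C_u=\{c\in C\mid \mathrm{wt}(c)=u\}$. AM-condition: the code $C$ satisfies the AM-condition for $t\in\mathbb{N}$ if $$d^{\perp}-t=\#\{u\mid C_u\neq\emptyset,\ 0<u\leq n-t\}.$$ *)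

(* Defs.v *)
From mathcomp Require Import all_boot all_order all_algebra.

Set Implicit Arguments.
Unset Strict Implicit.
Unset Printing Implicit Defensive.

Import GRing.Theory.
Local Open Scope ring_scope.

Definition wt (n : nat) (x : 'rV['F_2]_n) : nat := #|[set i | x 0 i != 0]|.

(* The span adds nothing: the orthogonality condition is already closed under
   linear combinations, see mem_dual_code. *)
Definition dual_code (n : nat) (C : {vspace 'rV['F_2]_n}) :
    {vspace 'rV['F_2]_n} :=
  span (enum [set y : 'rV['F_2]_n |
      [forall x in C, \sum_(i < n) x 0 i * y 0 i == 0]]).

Lemma mem_dual_code (n : nat) (C : {vspace 'rV['F_2]_n}) (y : 'rV['F_2]_n) :
  reflect (forall x, x \in C -> \sum_(i < n) x 0 i * y 0 i = 0)
          (y \in dual_code C).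
Proof.
rewrite /dual_code; set S := finset _.
apply: (iffP idP) => [yS x xC | Hy]; last first.
  apply: memv_span; rewrite mem_enum inE.
  by apply/'forall_implyP => x xC; apply/eqP; apply: Hy.
rewrite (coord_span (X := in_tuple (enum S)) yS).
under eq_bigr => i _ do rewrite summxE mulr_sumr.
rewrite exchange_big big1 // => j _ /=.
have: (enum S)`_j \in enum S by apply: mem_nth.
rewrite mem_enum inE => /'forall_implyP /(_ x xC) /eqP Hx.
under eq_bigr => i _ do rewrite mxE mulrCA.
by rewrite -mulr_sumr Hx mulr0.
Qed.

(* A relation rather than a function: the zero code has no minimum distance. *)
Definition is_min_dist (n : nat) (C : {vspace 'rV['F_2]_n}) (d : nat) : Prop :=
  (exists x, [/\ x \in C, x != 0 & wt x = d]) /\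
  (forall x, x \in C -> x != 0 -> (d <= wt x)%N).

Definition is_code (n k d : nat) (C : {vspace 'rV['F_2]_n}) : Prop :=
  \dim C = k /\ is_min_dist C d.

Definition all_one (n : nat) : 'rV['F_2]_n := const_mx 1.

Definition words_of_weight (n : nat) (C : {vspace 'rV['F_2]_n}) (u : nat) :
    {set 'rV['F_2]_n} :=
  [set c in C | wt c == u].

(* The left-hand side is an integer difference; truncation in n - t is harmless
   because of 0 < u. *)
Definition AM_condition (n : nat) (C : {vspace 'rV['F_2]_n}) (t : nat) : Prop :=
  exists dperp : nat, is_min_dist (dual_code C) dperp /\
    dperp%:Z - t%:Z =
      #|[set u : 'I_n.+1 |
          (words_of_weight C u != set0) && (0 < u <= n - t)%N]|%:Z.

(* Main.v *)
Require Import Defs.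
From mathcomp Require Import all_boot all_order all_algebra.
From mathcomp Require Import finfield.
From mathcomp Require Import zify ring lra.
From Stdlib Require BinNat.

(** Write s for dperp - t, so s is 4 or 5.  Words are identified with their
    supports.  The characters B |-> (-1)^|B /\ w| of weight below dperp average
    to zero over the code, so every function of degree below dperp in the signs
    (-1)^[i in B] has the same average over the code as over the whole space
    ([strength_supports], [sum_degree_le]).  Everything rests on this.

    It makes the Assmus-Mattson argument work: for a weight u <= n - t, the
    number of words of weight u vanishing on a t-set does not depend on the
    t-set ([avoiding_blocks]).  If moreover u < t, injectivity of the
    disjointness matrix between u-sets and t-sets forces all u-sets to be words
    ([all_blocks]).  A dual word of minimum weight is then constant, so it is the
    all-one word, dperp = n, and the s weights fill the interval from 1 to s; but
    a word of weight 1 is not orthogonal to it ([low_weights_ge]).  So every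
    weight in (0, n - t] is at least t.  By complementation (the all-one word is
    in C) all the weights strictly between 0 and n are among these s, they are
    symmetric about n/2, and n >= 2 t.

    Next, t <= s + 1 ([AM_offset_bound]).  Otherwise dperp >= 2 s + 2, the case of
    equality being that of an extended perfect code, and averages are known up
    to degree 2 s + 1.  With z = n - 2 wt, the polynomial vanishing on the s
    weights is z^4 - S z^2 + Q, times z when s = 5, where S = a^2 + b^2 and
    Q = a^2 b^2 for integers a, b.  Its orthogonality to low degrees gives S and
    Q as functions of n (this is Lloyd's theorem), and its average gives the
    product of the weights as 3 or 15 times a power of 2 ([lloyd_even],
    [lloyd_odd]).  Hence some weight u < n/2 has u (n - u) dividing 3 * 2^k,
    which keeps u away from n/2: 4 u <= 3 (n - u) ([unbalanced_factors]).  So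
    n <= 7 (n - 2 u), whereas (n - 2 u)^2 <= S is linear in n; this bounds n, and
    a finite search finds nothing with n >= 2 (s + 2).

    Finally dperp is even, as dual words are orthogonal to the all-one word
    ([dual_dist_even]), so t has the parity of s, and 0 < t <= s + 1 leaves the
    listed values. *)

Set Implicit Arguments.
Unset Strict Implicit.
Unset Printing Implicit Defensive.

Import GRing.Theory Num.Theory.
Local Open Scope ring_scope.

(** * Averages of functions of bounded degree *)

Section Averages.
Variable n : nat.
Implicit Types (B T X Y : {set 'I_n}) (F : {set {set 'I_n}}) (w : seq 'I_n).
Implicit Types (g h : {set 'I_n} -> rat).

Definition mean g : rat := (\sum_B g B) / (2 ^ n)%:R.
Definition sgn (i : 'I_n) B : rat := (-1) ^+ (i \in B).
(** The characters of the group of sets under symmetric difference, indexed by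
    sequences: repeated indices cancel, so that degrees add under products. *)
Definition character w B : rat := \prod_(i <- w) sgn i B.
(** The sum of the signs of B, the natural variable for a code that is closed
    under complement. *)
Definition balance B : rat := n%:R - 2 * #|B|%:R.

(** The family is an orthogonal array of this strength. *)
Definition strength F D := forall w, (size w <= D)%N ->
  \sum_(B in F) character w B = #|F|%:R * mean (character w).

(** Functions that are polynomials of bounded degree in the signs, presented by
    closure rules so that averages can be computed by induction. *)
Inductive degree_le : nat -> ({set 'I_n} -> rat) -> Prop :=
| degree_const a : degree_le 0 (fun=> a)
| degree_sgn i k g : degree_le k g -> degree_le k.+1 (fun B => sgn i B * g B)
| degree_add k g h : degree_le k g -> degree_le k h ->
    degree_le k (fun B => g B + h B)
| degree_up k g : degree_le k g -> degree_le k.+1 g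
| degree_ext k g h : g =1 h -> degree_le k g -> degree_le k h.

Lemma meanE g h a : (forall B, g B = a * h B) -> mean g = a * mean h.
Proof. by move=> E; rewrite /mean (eq_bigr _ (fun B _ => E B)) -mulr_sumr mulrA. Qed.

Lemma meanD g h : mean (fun B => g B + h B) = mean g + mean h.
Proof. by rewrite /mean big_split mulrDl. Qed.

Lemma eq_mean g h : g =1 h -> mean g = mean h.
Proof. by move=> E; rewrite /mean (eq_bigr _ (fun B _ => E B)). Qed.

(** The induction carries along an extra character: multiplying by a sign is
    absorbed into it. *)
Lemma sum_degree_le F D k g : strength F D -> degree_le k g -> (k <= D)%N ->
  \sum_(B in F) g B = #|F|%:R * mean g.
Proof.
move=> sF dg kD.
have main w : (size w + k <= D)%N ->
    \sum_(B in F) character w B * g B = #|F|%:R * mean (fun B => character w B * g B).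
  elim: {kD} k g / dg w => [a|i k g _ IH|k g h _ IHg _ IHh|k g _ IH|k g h E _ IH] w wD.
  - rewrite -mulr_suml sF ?(leq_trans _ wD) ?leq_addr //.
    have /meanE -> B : character w B * a = a * character w B by rewrite mulrC.
    by rewrite [RHS]mulrCA mulrC.
  - have E B : character w B * (sgn i B * g B) = character (i :: w) B * g B.
      by rewrite /character big_cons mulrA (mulrC _ (sgn i B)).
    by rewrite (eq_bigr _ (fun B _ => E B)) (eq_mean E) IH //= addSnnS.
  - rewrite (eq_bigr _ (fun B _ => mulrDr _ _ _)) big_split /= IHg // IHh //.
    by rewrite -mulrDr -meanD; congr (_ * _); apply: eq_mean => B; rewrite mulrDr.
  - by apply: IH; rewrite (leq_trans _ wD) // leq_add2l.
  - have E' B : character w B * h B = character w B * g B by rewrite E.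
    by rewrite (eq_bigr _ (fun B _ => E' B)) (eq_mean E') IH.
have C0 B : g B = character [::] B * g B by rewrite /character big_nil mul1r.
by rewrite (eq_bigr _ (fun B _ => C0 B)) (eq_mean C0) main.
Qed.

Lemma degree_mul k l g h : degree_le k g -> degree_le l h ->
  degree_le (k + l) (fun B => g B * h B).
Proof.
move=> dg dh; elim: k g / dg => [a|i k g _ IH|k g1 g2 _ IH1 _ IH2|k g _ IH|k g g' E _ IH].
- elim: l h / dh => [b|i k g _ IH|k g1 g2 _ IH1 _ IH2|k g _ IH|k g g' E _ IH].
  + exact: degree_const.
  + by apply: degree_ext (degree_sgn i IH) => B; rewrite mulrCA.
  + by apply: degree_ext (degree_add IH1 IH2) => B; rewrite mulrDr.
  + exact: degree_up.
  + by apply: degree_ext IH => B; rewrite E.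
- by apply: degree_ext (degree_sgn i IH) => B; rewrite mulrA.
- by apply: degree_ext (degree_add IH1 IH2) => B; rewrite mulrDl.
- exact: degree_up.
- by apply: degree_ext IH => B; rewrite E.
Qed.

Lemma degree_prod (I : Type) (r : seq I) (G : I -> {set 'I_n} -> rat) :
  (forall i, degree_le 1 (G i)) -> degree_le (size r) (fun B => \prod_(i <- r) G i B).
Proof.
move=> dG; elim: r => [|i r IH] /=.
  by apply: degree_ext (degree_const 1) => B; rewrite big_nil.
by apply: degree_ext (degree_mul (dG i) IH) => B; rewrite big_cons.
Qed.

Lemma degree_affine g a b : degree_le 1 g -> degree_le 1 (fun B => a * g B + b).
Proof.
move=> dg; apply: degree_add; last exact/degree_up/degree_const.
exact: (degree_mul (degree_const a) dg).
Qed.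

Lemma sgnE i B : sgn i B = 1 - 2 * (i \in B)%:R.
Proof. by rewrite /sgn; case: (i \in B); rewrite ?expr0 ?expr1 /=; lra. Qed.

Lemma degree_sgn1 i : degree_le 1 (sgn i).
Proof. by apply: degree_ext (degree_sgn i (degree_const 1)) => B; rewrite mulr1. Qed.

Lemma balanceE B : balance B = \sum_i sgn i B.
Proof.
rewrite (eq_bigr (fun i => 1 - 2 * (i \in B)%:R)) => [|i _]; last exact: sgnE.
rewrite sumrB -mulr_sumr -natr_sum sumr_const card_ord /balance.
by rewrite -sum1_card big_mkcond /=; congr (_ - _ * _%:R); apply: eq_bigr => i _; case: ifP.
Qed.

Lemma degree_balance : degree_le 1 balance.
Proof.
apply: (@degree_ext 1 (fun B => \sum_i sgn i B)) => [B|]; first by rewrite balanceE.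
elim: (index_enum _) => [|i r IH].
  by apply: degree_ext (degree_up (degree_const 0)) => B; rewrite big_nil.
by apply: degree_ext (degree_add (degree_sgn1 i) IH) => B; rewrite big_cons.
Qed.

Lemma degree_card_sub m : degree_le 1 (fun B => #|B|%:R - m%:R).
Proof.
apply: degree_ext (degree_affine (- 1 / 2) (n%:R / 2 - m%:R) degree_balance) => B.
by rewrite /balance; field.
Qed.

Lemma degree_balanceX k : degree_le k (fun B => balance B ^+ k).
Proof.
elim: k => [|k IH]; first by apply: degree_ext (degree_const 1).
by apply: degree_ext (degree_mul degree_balance IH) => B; rewrite exprS.
Qed.

(** Disjointness is the product over T of the factors (1 + sign) / 2. *)
Lemma degree_disjoint T : degree_le #|T| (fun B => [disjoint B & T]%:R).
Proof.
rewrite cardE.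
apply: degree_ext (@degree_prod _ (enum T) (fun i B => 1 / 2 * sgn i B + 1 / 2) _) => [B|i].
  rewrite big_enum /= -setI_eq0.
  have E i : 1 / 2 * sgn i B + 1 / 2 = (i \notin B)%:R.
    by rewrite sgnE; case: (i \in B) => /=; lra.
  rewrite (eq_bigr _ (fun i _ => E i)).
  have [/setP BT|/set0Pn[i]] := eqVneq.
    by rewrite big1 // => i iT; have := BT i; rewrite !inE iT andbT => ->.
  by rewrite inE => /andP[iB iT]; rewrite (bigD1 i) //= iB mul0r.
exact/degree_affine/degree_sgn1.
Qed.

Lemma sum_subset_card (A : {set 'I_n}) (f : nat -> rat) :
  \sum_(B : {set 'I_n} | B \subset A) f #|B| = \sum_(j < n.+1) 'C(#|A|, j)%:R * f j.
Proof.
have P B : (#|B| < n.+1)%N by rewrite ltnS -[X in (_ <= X)%N]card_ord max_card.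
rewrite (partition_big (fun B => Ordinal (P B)) xpredT) //=; apply: eq_bigr => j _.
rewrite (eq_bigr (fun=> f j)) => [|B /andP[_ /eqP <-] //].
rewrite sumr_const -cards_draws mulr_natl; congr (_ *+ _).
by apply: eq_card => B; rewrite !inE.
Qed.

(** What matters is that the right-hand side sees T only through its size. *)
Lemma mean_disjoint T (f : nat -> rat) :
  mean (fun B => [disjoint B & T]%:R * f #|B|) =
  (\sum_(j < n.+1) 'C(n - #|T|, j)%:R * f j) / (2 ^ n)%:R.
Proof.
rewrite /mean; congr (_ / _).
have <- : #|~: T| = (n - #|T|)%N by have := cardsC T; rewrite card_ord; lia.
rewrite -sum_subset_card [RHS]big_mkcond /=; apply: eq_bigr => B _.
rewrite disjoints_subset; case: ifP => _; by rewrite ?mul1r ?mul0r.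
Qed.

End Averages.

(** * Even moments of a sum of independent signs *)

Definition binomial_sum n (f : rat -> rat) : rat :=
  \sum_(j < n.+1) 'C(n, j)%:R * f (n%:R - 2 * j%:R).

(** One more sign is 1 or -1, which is Pascal's rule. *)
Lemma binomial_sumS n f :
  binomial_sum n.+1 f = binomial_sum n (fun z => f (z + 1) + f (z - 1)).
Proof.
rewrite /binomial_sum [LHS]big_ord_recl /=.
rewrite (eq_bigr (fun j : 'I_n.+1 => 'C(n, j.+1)%:R * f (n%:R - 2 * j.+1%:R + 1)
   + 'C(n, j)%:R * f (n%:R - 2 * j%:R - 1))) => [|j _]; last first.
  rewrite /bump /= add1n binS natrD mulrDl; congr (_ * f _ + _ * f _);
    rewrite -!natr1; ring.
rewrite big_split /= addrA.
under [RHS]eq_bigr do rewrite mulrDr.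
rewrite big_split /=; congr (_ + _).
rewrite [X in _ + X]big_ord_recr /= [in 'C(_, n.+1)]bin_small // mul0r !addr0.
rewrite [RHS]big_ord_recl /= !bin0; congr (_ * f _ + _).
rewrite -natr1; ring.
Qed.

(** Each moment at n.+1 is a combination of the even moments at n of at most the
    same order, by expanding (z + 1)^k + (z - 1)^k. *)
Lemma moments n :
  [/\ binomial_sum n (fun=> 1) = 2 ^+ n,
      binomial_sum n (fun z => z ^+ 2) = 2 ^+ n * n%:R,
      binomial_sum n (fun z => z ^+ 4) = 2 ^+ n * (3 * n%:R ^+ 2 - 2 * n%:R),
      binomial_sum n (fun z => z ^+ 6) =
        2 ^+ n * (15 * n%:R ^+ 3 - 30 * n%:R ^+ 2 + 16 * n%:R) &
      binomial_sum n (fun z => z ^+ 8) = 2 ^+ n *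
        (105 * n%:R ^+ 4 - 420 * n%:R ^+ 3 + 588 * n%:R ^+ 2 - 272 * n%:R)
   /\ binomial_sum n (fun z => z ^+ 10) = 2 ^+ n *
        (945 * n%:R ^+ 5 - 6300 * n%:R ^+ 4 + 16380 * n%:R ^+ 3
         - 18960 * n%:R ^+ 2 + 7936 * n%:R)].
Proof.
elim: n => [|n [h0 h2 h4 h6 [h8 h10]]].
  by split; last split; rewrite /binomial_sum big_ord1 /= bin0; ring.
have lin a b c d e k f : (forall z, f (z + 1) + f (z - 1) =
    a * 1 + b * z ^+ 2 + c * z ^+ 4 + d * z ^+ 6 + e * z ^+ 8 + k * z ^+ 10) ->
   binomial_sum n.+1 f = a * binomial_sum n (fun=> 1)
   + b * binomial_sum n (fun z => z ^+ 2) + c * binomial_sum n (fun z => z ^+ 4)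
   + d * binomial_sum n (fun z => z ^+ 6) + e * binomial_sum n (fun z => z ^+ 8)
   + k * binomial_sum n (fun z => z ^+ 10).
  move=> E; rewrite binomial_sumS /binomial_sum !mulr_sumr -!big_split /=.
  by apply: eq_bigr => j _; rewrite E; ring.
rewrite exprS -(natr1 n); move: (2 ^+ n) (n%:R) h0 h2 h4 h6 h8 h10 => p x.
move=> h0 h2 h4 h6 h8 h10; split; last split.
- rewrite (lin 2 0 0 0 0 0) => [|z]; last ring. by rewrite h0 h2 h4 h6 h8 h10; ring.
- rewrite (lin 2 2 0 0 0 0) => [|z]; last ring. by rewrite h0 h2 h4 h6 h8 h10; ring.
- rewrite (lin 2 12 2 0 0 0) => [|z]; last ring. by rewrite h0 h2 h4 h6 h8 h10; ring.
- rewrite (lin 2 30 30 2 0 0) => [|z]; last ring. by rewrite h0 h2 h4 h6 h8 h10; ring.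
- rewrite (lin 2 56 140 56 2 0) => [|z]; last ring. by rewrite h0 h2 h4 h6 h8 h10; ring.
- rewrite (lin 2 90 420 420 90 2) => [|z]; last ring. by rewrite h0 h2 h4 h6 h8 h10; ring.
Qed.

(** * Assmus-Mattson regularity *)

Lemma disjoint_setU1r (I : finType) (i : I) (B X : {set I}) :
  [disjoint B & i |: X] = (i \notin B) && [disjoint B & X].
Proof. by rewrite !(disjoint_sym B) -!setI_eq0 setIUl setU_eq0 setI_eq0 disjoints1. Qed.

(** The disjointness matrix between u-sets and t-sets is injective for
    u <= t <= n - u.  Averaging over the t-sets containing X shows that the sums
    over blocks avoiding X vanish for every X of size at most t; inclusion and
    exclusion then gives the sums over blocks that avoid X and contain Y, and
    with X empty and #|Y| = u only the block Y is left. *)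
Lemma disjoint_sums_inj n u t (f : {set 'I_n} -> rat) :
  (u <= t)%N -> (u + t <= n)%N ->
  (forall T : {set 'I_n}, #|T| = t ->
     \sum_(B : {set 'I_n} | (#|B| == u) && [disjoint B & T]) f B = 0) ->
  forall Y : {set 'I_n}, #|Y| = u -> f Y = 0.
Proof.
move=> ut utn f0.
have avoid (X : {set 'I_n}) : (#|X| <= t)%N ->
    \sum_(B : {set 'I_n} | (#|B| == u) && [disjoint B & X]) f B = 0.
  move=> /subnKC; move: (t - #|X|)%N => m; elim: m X => [|m IH] X Xm.
    by apply: f0; rewrite addn0 in Xm.
  have : \sum_(x in ~: X) \sum_(B : {set 'I_n} | (#|B| == u) && [disjoint B & x |: X]) f B = 0.
    apply: big1 => x; rewrite inE => xX; apply: IH; rewrite cardsU1 xX; lia.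
  rewrite (exchange_big_dep (fun B : {set 'I_n} => (#|B| == u) && [disjoint B & X])) /=; last first.
    move=> x B _ /andP[-> /=]; apply: disjointWr; exact: subsetUr.
  rewrite (eq_bigr (fun B => (n - u - #|X|)%:R * f B)) => [|B /andP[/eqP Bu BX]].
    rewrite -mulr_sumr => /eqP; rewrite mulf_eq0 pnatr_eq0 => /orP[|/eqP //]; lia.
  rewrite sumr_const mulr_natl; congr (_ *+ _).
  have -> : #|[pred i in ~: X | (#|B| == u) && [disjoint B & i |: X]]| = #|~: (X :|: B)|.
    apply: eq_card => i; rewrite !inE Bu eqxx /= negb_or; congr (_ && _).
    by rewrite disjoint_setU1r BX andbT.
  have := cardsC (X :|: B); rewrite card_ord cardsU Bu.
  by rewrite setIC (disjoint_setI0 BX) cards0; lia.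
have split_sum (Y X : {set 'I_n}) : (#|X| + #|Y| <= t)%N ->
    \sum_(B : {set 'I_n} | [&& #|B| == u, [disjoint B & X] & Y \subset B]) f B = 0.
  move: {2}#|Y| (erefl #|Y|) => m; elim: m Y X => [|m IH] Y X Ym XY.
    move/eqP: Ym; rewrite cards_eq0 => /eqP->.
    under eq_bigl do rewrite sub0set andbT.
    by apply: avoid; lia.
  have /card_gt0P[y yY] : (0 < #|Y|)%N by rewrite Ym.
  have Ydel : #|Y :\ y| = m by have := cardsD1 y Y; rewrite yY Ym; lia.
  have hX : (#|y |: X| <= #|X|.+1)%N by rewrite cardsU1; case: (_ \notin _); lia.
  have := IH (Y :\ y) X Ydel; rewrite Ydel => /(_ ltac:(lia)).
  rewrite (bigID (fun B : {set 'I_n} => y \in B)) /=.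
  rewrite [X in _ + X](eq_bigl (fun B : {set 'I_n} =>
      [&& #|B| == u, [disjoint B & y |: X] & Y :\ y \subset B])) => [|B]; last first.
    by rewrite disjoint_setU1r; case: (y \in B); rewrite ?andbF ?andbT.
  rewrite IH ?Ydel ?addr0; [|by []|lia].
  move=> h; rewrite -[RHS]h; apply: eq_bigl => B; rewrite -!andbA; congr [&& _, _ & _].
  by rewrite -{1}(setD1K yY) subUset sub1set andbC.
move=> Y Yu; have := split_sum Y set0; rewrite cards0 add0n Yu => /(_ ut).
rewrite (bigD1 Y) /= ?Yu ?eqxx ?subxx ?andbT; last first.
  by rewrite disjoint_sym disjoints_subset sub0set.
rewrite big1 ?addr0 // => B /andP[/and3P[/eqP Bu _ YB]] /eqP[].
by apply/esym/eqP; rewrite eqEcard YB Bu Yu /=.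
Qed.

Section Family.
Variables (n : nat) (F : {set {set 'I_n}}).

(** The product of #|B| - w over the weights w other than u, restricted to the B
    disjoint from T, has degree t + size W - 1.  Among the sets of F it is
    supported on the empty set and on the blocks of size u that are counted
    here, and its average depends only on #|T|. *)
Lemma avoiding_blocks t (W : seq nat) u (T T' : {set 'I_n}) :
  strength F (t + size W).-1 -> set0 \in F -> 0%N \notin W -> uniq W ->
  (forall B, B \in F -> B != set0 -> (#|B| + t <= n)%N -> #|B| \in W) ->
  u \in W -> #|T| = t -> #|T'| = t ->
  \sum_(B in F | #|B| == u) [disjoint B & T]%:R =
  \sum_(B in F | #|B| == u) [disjoint B & T']%:R :> rat.
Proof.
move=> sF F0 W0 uW FW uinW.
pose p B : rat := \prod_(w <- rem u W) (#|B : {set 'I_n}|%:R - w%:R).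
have main (S : {set 'I_n}) : #|S| = t ->
    \sum_(B in F | #|B| == u) [disjoint B & S]%:R * (\prod_(w <- rem u W) (u%:R - w%:R)) =
    #|F|%:R * ((\sum_(j < n.+1) 'C(n - t, j)%:R * \prod_(w <- rem u W) (j%:R - w%:R)) / (2 ^ n)%:R)
    - \prod_(w <- rem u W) (0%:R - w%:R) :> rat.
  move=> St.
  have Wpos : (0 < size W)%N by case: (W) uinW.
  have deg : degree_le (t + (size W).-1) (fun B => [disjoint B & S]%:R * p B).
    rewrite -St -(size_rem uinW); apply: degree_mul (degree_disjoint S) _.
    by apply: degree_prod => w; exact: degree_card_sub.
  have := sum_degree_le sF deg; rewrite -[X in (_ <= X)%N]subn1 -subn1.
  rewrite addnBA // => /(_ (leqnn _)).
  rewrite -St -(mean_disjoint S (fun j => \prod_(w <- rem u W) (j%:R - w%:R))) => <-.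
  have S0 : [disjoint set0 & S] by rewrite -setI_eq0 set0I.
  rewrite [X in _ = X - _](bigD1 set0) // S0 mul1r /p cards0 /= addrAC subrr add0r.
  rewrite [RHS](bigID (fun B : {set 'I_n} => #|B| == u)) /= [X in _ + X]big1 ?addr0.
    apply: eq_big => [B|B /andP[_ /eqP->] //].
    case: eqP => [Bu|]; rewrite ?andbF // !andbT; case: eqP => [B0|]; last by rewrite andbT.
    by move: W0; rewrite -(cards0 'I_n) -B0 Bu uinW.
  move=> B /andP[/andP[BF B0] Bu].
  case: (boolP [disjoint B & S]) => [BS|]; rewrite ?mul0r // mul1r.
  have BW : #|B| \in rem u W.
    rewrite mem_rem_uniq // !inE Bu; apply: FW => //.
    have := max_card (mem (B :|: S)).
    by rewrite card_ord cardsU (disjoint_setI0 BS) cards0 St; lia.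
  by rewrite (big_rem _ BW) /= subrr mul0r.
move=> /main h /main; rewrite -{}h -!mulr_suml => /esym/mulIf; apply.
rewrite prodf_seq_neq0; apply/allP => w; rewrite mem_rem_uniq // inE => /andP[wu _].
by rewrite subr_eq0 eqr_nat eq_sym.
Qed.

(** By regularity the indicator of the blocks of size u has, on t-sets, the same
    avoidance counts as a constant function, hence it is constant. *)
Lemma all_blocks t (W : seq nat) u (Y : {set 'I_n}) :
  strength F (t + size W).-1 -> set0 \in F -> 0%N \notin W -> uniq W ->
  (forall B, B \in F -> B != set0 -> (#|B| + t <= n)%N -> #|B| \in W) ->
  u \in W -> (u <= t)%N -> (u + t <= n)%N -> 
  (exists2 B, B \in F & #|B| = u) -> #|Y| = u -> Y \in F.
Proof.
move=> sF F0 W0 uW FW uinW ut utn [B0 B0F B0u] Yu.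
have [T0 T0t] : exists T : {set 'I_n}, #|T| = t.
  have : (0 < #|[set A : {set 'I_n} | A \subset setT & #|A| == t]|)%N.
    by rewrite cards_draws cardsT card_ord bin_gt0; lia.
  by case/card_gt0P => T; rewrite inE => /andP[_ /eqP]; exists T.
pose a : rat := \sum_(B in F | #|B| == u) [disjoint B & T0]%:R.
pose f (B : {set 'I_n}) : rat := (B \in F)%:R - a / 'C(n - t, u)%:R.
have C0 : 'C(n - t, u)%:R != 0 :> rat by rewrite pnatr_eq0 -lt0n bin_gt0; lia.
have fE : forall Z : {set 'I_n}, #|Z| = u -> f Z = 0.
  apply: (disjoint_sums_inj ut utn) => T Tt; rewrite sumrB.
  apply/eqP; rewrite subr_eq0 sumr_const; apply/eqP; transitivity a.
    rewrite /a -(avoiding_blocks sF F0 W0 uW FW uinW Tt T0t).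
    rewrite big_mkcond [RHS]big_mkcond /=; apply: eq_bigr => B _.
    by case: (B \in F); case: (#|B| == u); case: [disjoint B & T].
  rewrite -[RHS]mulr_natr -[RHS]mulrA -[LHS]mulr1; congr (_ * _).
  have -> : #|[pred B : {set 'I_n} | (#|B| == u) && [disjoint B & T]]| = 'C(n - t, u).
    have <- : #|~: T| = (n - t)%N by have := cardsC T; rewrite card_ord Tt; lia.
    rewrite -cards_draws; apply: eq_card => B; rewrite !inE andbC.
    by rewrite disjoints_subset.
  by rewrite mulVf.
have := fE _ B0u; rewrite -(fE _ Yu) /f B0F => /addIr/eqP.
by rewrite eqr_nat; case: (Y \in F).
Qed.

End Family.

(** * Lloyd equations *)

Section PowerSums.
Variables (n D : nat) (F : {set {set 'I_n}}).
Hypothesis sF : strength F D.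

Lemma power_sum k : (k <= D)%N ->
  \sum_(B in F) balance B ^+ k =
  #|F|%:R * (binomial_sum n (fun z => z ^+ k) / 2 ^+ n).
Proof.
move=> kD; rewrite (sum_degree_le sF (degree_balanceX n k) kD) /mean natrX.
congr (_ * (_ / _)).
have := sum_subset_card [set: 'I_n] (fun j => (n%:R - 2 * j%:R) ^+ k).
rewrite cardsT card_ord /binomial_sum => <-.
by apply: eq_bigl => B; rewrite subsetT.
Qed.

Lemma power_sums : (8 <= D)%N ->
  [/\ \sum_(B in F) balance B ^+ 0 = #|F|%:R,
      \sum_(B in F) balance B ^+ 2 = #|F|%:R * n%:R,
      \sum_(B in F) balance B ^+ 4 = #|F|%:R * (3 * n%:R ^+ 2 - 2 * n%:R),
      \sum_(B in F) balance B ^+ 6 =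
        #|F|%:R * (15 * n%:R ^+ 3 - 30 * n%:R ^+ 2 + 16 * n%:R) &
      \sum_(B in F) balance B ^+ 8 = #|F|%:R *
        (105 * n%:R ^+ 4 - 420 * n%:R ^+ 3 + 588 * n%:R ^+ 2 - 272 * n%:R)
   /\ ((10 <= D)%N -> \sum_(B in F) balance B ^+ 10 = #|F|%:R *
        (945 * n%:R ^+ 5 - 6300 * n%:R ^+ 4 + 16380 * n%:R ^+ 3
         - 18960 * n%:R ^+ 2 + 7936 * n%:R))].
Proof.
move=> D8; have p0 : 2 ^+ n != 0 :> rat by rewrite expf_neq0.
have [h0 h2 h4 h6 [h8 h10]] := moments n.
have of_moment k m : binomial_sum n (fun z => z ^+ k) = 2 ^+ n * m -> (k <= D)%N ->
    \sum_(B in F) balance B ^+ k = #|F|%:R * m.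
  by move=> hk kD; rewrite power_sum // hk mulrAC mulfV ?mul1r.
split; first by rewrite sumr_const.
- exact: of_moment h2 (leq_trans (isT : 2 <= 8)%N D8).
- exact: of_moment h4 (leq_trans (isT : 4 <= 8)%N D8).
- exact: of_moment h6 (leq_trans (isT : 6 <= 8)%N D8).
by split; [exact: of_moment h8 _ | exact: of_moment h10].
Qed.

(** The code is summed against the quartic times 1, times n^2 - z^2 and times
    (n^2 - z^2) z^2.  The last two sums vanish, as n^2 - z^2 removes the words of
    weight 0 and n; after division by n (n - 1) they say that the quartic is
    orthogonal to 1 and z^2 for the binomial weights of length n - 2. *)
Lemma lloyd_even (S Q : rat) : (8 <= D)%N -> (3 < n)%N -> set0 \in F -> setT \in F ->
  (forall B, B \in F -> B != set0 -> B != setT ->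
     balance B ^+ 4 - S * balance B ^+ 2 + Q = 0) ->
  [/\ S = 6 * n%:R - 20, Q = 3 * (n%:R - 2) * (n%:R - 4)
    & n%:R ^+ 4 - S * n%:R ^+ 2 + Q = 12 * #|F|%:R].
Proof.
move=> D8 n3 F0 FT FP.
have bal0 : balance (set0 : {set 'I_n}) = n%:R by rewrite /balance cards0 mulr0 subr0.
have balT : balance [set: 'I_n] = - n%:R by rewrite /balance cardsT card_ord; ring.
have TN0 : [set: 'I_n] != set0 by rewrite -card_gt0 cardsT card_ord; lia.
have Fn0 : #|F|%:R != 0 :> rat.
  by rewrite pnatr_eq0 -lt0n; apply/card_gt0P; exists set0.
have x0 : n%:R != 0 :> rat by rewrite pnatr_eq0; lia.
have x1 : n%:R - 1 != 0 :> rat by rewrite subr_eq0 pnatr_eq1; lia.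
have x2 : n%:R - 2 != 0 :> rat by rewrite subr_eq0 eqr_nat; lia.
have x3 : n%:R - 3 != 0 :> rat by rewrite subr_eq0 eqr_nat; lia.
have [p0 p2 p4 p6 [p8 _]] := power_sums D8.
(* Only the words of weight 0 and n contribute to a sum against the quartic. *)
have key (g : {set 'I_n} -> rat) :
    \sum_(B in F) g B * (balance B ^+ 4 - S * balance B ^+ 2 + Q) =
    (g set0 + g setT) * (n%:R ^+ 4 - S * n%:R ^+ 2 + Q).
  rewrite (bigD1 set0) // (bigD1 setT) ?FT //= big1 => [|B /andP[/andP[BF B0] BT]].
    by rewrite bal0 balT; ring.
  by rewrite FP ?mulr0.
have := key (fun=> 1); have := key (fun B => n%:R ^+ 2 - balance B ^+ 2).
have := key (fun B => (n%:R ^+ 2 - balance B ^+ 2) * balance B ^+ 2).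
rewrite bal0 balT.
have -> : \sum_(B in F) 1 * (balance B ^+ 4 - S * balance B ^+ 2 + Q) =
  (\sum_(B in F) balance B ^+ 4) - S * (\sum_(B in F) balance B ^+ 2)
  + Q * (\sum_(B in F) balance B ^+ 0).
  rewrite !mulr_sumr -sumrB -big_split; apply: eq_bigr => B _ /=; ring.
have -> : \sum_(B in F) (n%:R ^+ 2 - balance B ^+ 2) *
    (balance B ^+ 4 - S * balance B ^+ 2 + Q) =
  (n%:R ^+ 2 + S) * (\sum_(B in F) balance B ^+ 4)
  - (n%:R ^+ 2 * S + Q) * (\sum_(B in F) balance B ^+ 2)
  + n%:R ^+ 2 * Q * (\sum_(B in F) balance B ^+ 0) - \sum_(B in F) balance B ^+ 6.
  rewrite !mulr_sumr -sumrB -big_split -sumrB; apply: eq_bigr => B _ /=; ring.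
have -> : \sum_(B in F) (n%:R ^+ 2 - balance B ^+ 2) * balance B ^+ 2 *
    (balance B ^+ 4 - S * balance B ^+ 2 + Q) =
  (n%:R ^+ 2 + S) * (\sum_(B in F) balance B ^+ 6)
  - (n%:R ^+ 2 * S + Q) * (\sum_(B in F) balance B ^+ 4)
  + n%:R ^+ 2 * Q * (\sum_(B in F) balance B ^+ 2) - \sum_(B in F) balance B ^+ 8.
  rewrite !mulr_sumr -sumrB -big_split -sumrB; apply: eq_bigr => B _ /=; ring.
rewrite p0 p2 p4 p6 p8.
set q := #|F|%:R in Fn0 *; set x := n%:R in x0 x1 x2 x3 * => e2 e1 e0.
(* The values 3 m^2 - 2 m and m, with m = n - 2, are moments of length m. *)
have E1 : 3 * (x - 2) ^+ 2 - 2 * (x - 2) - S * (x - 2) + Q = 0.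
  apply: (mulfI (mulf_neq0 Fn0 (mulf_neq0 x0 x1))); rewrite mulr0.
  by apply: etrans (etrans e1 _); ring.
have E2 : 15 * (x - 2) ^+ 3 - 30 * (x - 2) ^+ 2 + 16 * (x - 2)
    - S * (3 * (x - 2) ^+ 2 - 2 * (x - 2)) + Q * (x - 2) = 0.
  apply: (mulfI (mulf_neq0 Fn0 (mulf_neq0 x0 x1))); rewrite mulr0.
  by apply: etrans (etrans e2 _); ring.
have ES : S = 6 * x - 20.
  apply: (mulfI (mulf_neq0 x2 x3)).
  have : (15 * (x - 2) ^+ 3 - 30 * (x - 2) ^+ 2 + 16 * (x - 2)
    - S * (3 * (x - 2) ^+ 2 - 2 * (x - 2)) + Q * (x - 2)) - (x - 2) *
    (3 * (x - 2) ^+ 2 - 2 * (x - 2) - S * (x - 2) + Q) = 0.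
    by rewrite E1 E2 mulr0 subr0.
  by clear; lra.
have EQ : Q = 3 * (x - 2) * (x - 4) by move: E1; rewrite ES; clear; lra.
split; [by [] | by [] |].
by move: e0; rewrite ES EQ; clear; lra.
Qed.

(** As for [lloyd_even], now with z (z^4 - S z^2 + Q) multiplied by z, so that only
    even moments occur. *)
Lemma lloyd_odd (S Q : rat) : (10 <= D)%N -> (4 < n)%N -> set0 \in F -> setT \in F ->
  (forall B, B \in F -> B != set0 -> B != setT ->
     balance B ^+ 2 * (balance B ^+ 4 - S * balance B ^+ 2 + Q) = 0) ->
  [/\ S = 10 * n%:R - 40, Q = 15 * n%:R ^+ 2 - 110 * n%:R + 184
    & n%:R * (n%:R ^+ 4 - S * n%:R ^+ 2 + Q) = 60 * #|F|%:R].
Proof.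
move=> D10 n4 F0 FT FP.
have bal0 : balance (set0 : {set 'I_n}) = n%:R by rewrite /balance cards0 mulr0 subr0.
have balT : balance [set: 'I_n] = - n%:R by rewrite /balance cardsT card_ord; ring.
have TN0 : [set: 'I_n] != set0 by rewrite -card_gt0 cardsT card_ord; lia.
have Fn0 : #|F|%:R != 0 :> rat.
  by rewrite pnatr_eq0 -lt0n; apply/card_gt0P; exists set0.
have x0 : n%:R != 0 :> rat by rewrite pnatr_eq0; lia.
have x1 : n%:R - 1 != 0 :> rat by rewrite subr_eq0 pnatr_eq1; lia.
have x2 : n%:R - 2 != 0 :> rat by rewrite subr_eq0 eqr_nat; lia.
have x3 : n%:R - 3 != 0 :> rat by rewrite subr_eq0 eqr_nat; lia.
have x4 : n%:R - 4 != 0 :> rat by rewrite subr_eq0 eqr_nat; lia.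
have [p0 p2 p4 p6 [p8 /(_ D10) p10]] := power_sums (leq_trans (isT : 8 <= 10)%N D10).
have key (g : {set 'I_n} -> rat) :
    \sum_(B in F) g B * (balance B ^+ 2 * (balance B ^+ 4 - S * balance B ^+ 2 + Q)) =
    (g set0 + g setT) * (n%:R ^+ 2 * (n%:R ^+ 4 - S * n%:R ^+ 2 + Q)).
  rewrite (bigD1 set0) // (bigD1 setT) ?FT //= big1 => [|B /andP[/andP[BF B0] BT]].
    by rewrite bal0 balT; ring.
  by rewrite FP ?mulr0.
have := key (fun=> 1); have := key (fun B => n%:R ^+ 2 - balance B ^+ 2).
have := key (fun B => (n%:R ^+ 2 - balance B ^+ 2) * balance B ^+ 2).
rewrite bal0 balT.
have -> : \sum_(B in F) 1 * (balance B ^+ 2 * (balance B ^+ 4 - S * balance B ^+ 2 + Q)) =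
  (\sum_(B in F) balance B ^+ 6) - S * (\sum_(B in F) balance B ^+ 4)
  + Q * (\sum_(B in F) balance B ^+ 2).
  rewrite !mulr_sumr -sumrB -big_split; apply: eq_bigr => B _ /=; ring.
have -> : \sum_(B in F) (n%:R ^+ 2 - balance B ^+ 2) *
    (balance B ^+ 2 * (balance B ^+ 4 - S * balance B ^+ 2 + Q)) =
  (n%:R ^+ 2 + S) * (\sum_(B in F) balance B ^+ 6)
  - (n%:R ^+ 2 * S + Q) * (\sum_(B in F) balance B ^+ 4)
  + n%:R ^+ 2 * Q * (\sum_(B in F) balance B ^+ 2) - \sum_(B in F) balance B ^+ 8.
  rewrite !mulr_sumr -sumrB -big_split -sumrB; apply: eq_bigr => B _ /=; ring.
have -> : \sum_(B in F) (n%:R ^+ 2 - balance B ^+ 2) * balance B ^+ 2 *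
    (balance B ^+ 2 * (balance B ^+ 4 - S * balance B ^+ 2 + Q)) =
  (n%:R ^+ 2 + S) * (\sum_(B in F) balance B ^+ 8)
  - (n%:R ^+ 2 * S + Q) * (\sum_(B in F) balance B ^+ 6)
  + n%:R ^+ 2 * Q * (\sum_(B in F) balance B ^+ 4) - \sum_(B in F) balance B ^+ 10.
  rewrite !mulr_sumr -sumrB -big_split -sumrB; apply: eq_bigr => B _ /=; ring.
rewrite p2 p4 p6 p8 p10.
set q := #|F|%:R in Fn0 *; set x := n%:R in x0 x1 x2 x3 x4 * => e2 e1 e0.
have cancel := mulf_neq0 (mulf_neq0 Fn0 (mulf_neq0 x0 x1)) x2.
have E1 : 15 * (x - 2) ^+ 2 - 30 * (x - 2) + 16 - S * (3 * (x - 2) - 2) + Q = 0.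
  by apply: (mulfI cancel); rewrite mulr0; apply: etrans (etrans e1 _); ring.
have E2 : 105 * (x - 2) ^+ 3 - 420 * (x - 2) ^+ 2 + 588 * (x - 2) - 272
    - S * (15 * (x - 2) ^+ 2 - 30 * (x - 2) + 16) + Q * (3 * (x - 2) - 2) = 0.
  by apply: (mulfI cancel); rewrite mulr0; apply: etrans (etrans e2 _); ring.
have ES : S = 10 * x - 40.
  apply: (mulfI (mulf_neq0 x3 x4)).
  have : (105 * (x - 2) ^+ 3 - 420 * (x - 2) ^+ 2 + 588 * (x - 2) - 272
    - S * (15 * (x - 2) ^+ 2 - 30 * (x - 2) + 16) + Q * (3 * (x - 2) - 2))
    - (3 * (x - 2) - 2) *
    (15 * (x - 2) ^+ 2 - 30 * (x - 2) + 16 - S * (3 * (x - 2) - 2) + Q) = 0.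
    by rewrite E1 E2 mulr0 subr0.
  by clear; lra.
have EQ : Q = 15 * x ^+ 2 - 110 * x + 184 by move: E1; rewrite ES; clear; lra.
split; [by [] | by [] |].
by apply: (mulfI x0); move: e0; rewrite ES EQ; clear; lra.
Qed.

End PowerSums.

(** * The Diophantine equations *)

(** The factors are powers of 2, at most one of them multiplied by 3.  Two
    distinct such numbers with product of 3-adic valuation at most one have
    ratio at most 3/4: the closest are 3 * 2^i and 4 * 2^i. *)
Lemma unbalanced_factors x y k :
  (x < y)%N -> (x * y %| 3 * 2 ^ k)%N -> (4 * x <= 3 * y)%N.
Proof.
move=> xy.
have pow z : (z %| 2 ^ k)%N -> exists i, z = (2 ^ i)%N.
  by case/dvdn_pfactor=> // i _ ->; exists i.
have pow2 a b : (a * b %| 2 ^ k)%N -> exists i j, a = (2 ^ i)%N /\ b = (2 ^ j)%N.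
  move=> ab; have [i ->] := pow _ (dvdn_trans (dvdn_mulr b (dvdnn a)) ab).
  by have [j ->] := pow _ (dvdn_trans (dvdn_mull a (dvdnn b)) ab); exists i, j.
have [/dvdnP[z xE]|nx3] := boolP (3 %| x)%N.
  rewrite xE mulnAC (mulnC _ 3) dvdn_pmul2l // => /pow2[i [j [zi yj]]].
  move: xy; rewrite {}xE {}zi {}yj => xy.
  have [ij|ij] := leqP j i.+1.
    have : (2 ^ j <= 2 ^ i.+1)%N by rewrite leq_exp2l.
    by move: xy; rewrite expnS; lia.
  have : (2 ^ i.+2 <= 2 ^ j)%N by rewrite leq_exp2l.
  by rewrite !expnS; lia.
have [/dvdnP[z yE]|ny3] := boolP (3 %| y)%N.
  rewrite yE mulnA (mulnC _ 3) dvdn_pmul2l // => /pow2[i [j [xi zj]]].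
  move: xy; rewrite {}yE {}xi {}zj => xy.
  have [ij|ij] := leqP i j.+1.
    have : (2 ^ i <= 2 ^ j.+1)%N by rewrite leq_exp2l.
    by rewrite expnS; lia.
  have : (2 ^ j.+2 <= 2 ^ i)%N by rewrite leq_exp2l.
  by move: xy; rewrite !expnS; lia.
rewrite Gauss_dvdr => [/pow2[i [j [xi yj]]]|]; last first.
  by rewrite coprimeMl ![coprime _ 3]coprime_sym !prime_coprime // nx3 ny3.
move: xy; rewrite {}xi {}yj ltn_exp2l // => ij.
have : (2 ^ i.+1 <= 2 ^ j)%N by rewrite leq_exp2l.
by rewrite expnS; lia.
Qed.

Local Notation toN := BinNat.N.of_nat.
Local Notation addN := BinNat.N.add.
Local Notation subN := BinNat.N.sub.
Local Notation mulN := BinNat.N.mul.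
Local Notation eqN := BinNat.N.eqb.
Local Notation ltN := BinNat.N.ltb.

(** The search is run on binary numbers, as the products involved are too large
    for unary ones. *)
Lemma search_pairs (test : BinNums.N -> BinNums.N -> bool) p q a b :
  all (fun a => all (fun b => test (toN a) (toN b)) (iota 0 q))
    (iota 0 p) -> (a < p)%N -> (b < q)%N ->
  test (toN a) (toN b).
Proof.
move=> /allP/(_ a); rewrite mem_iota => h ap; have /allP := h ap.
by move=> /(_ b); rewrite mem_iota; apply.
Qed.

(** The bound n <= 7 a turns a^2 < 6 n into a <= 42.  Eliminating n leaves a test on a
    and b alone; the cutoff 52 on a^2 + b^2 expresses n < 12 and discards small
    solutions such as (a, b, n) = (6, 2, 10), which comes from the even-weight
    code of length 10. *)
Lemma four_weights_no_solution a b n : (12 <= n)%N -> (n <= 7 * a)%N ->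
  (a * a + b * b + 20 = 6 * n)%N -> ((a * a) * (b * b) = 3 * (n - 2) * (n - 4))%N -> False.
Proof.
move=> n12 na S Q.
have sq m c : (m * m <= c * c)%N -> (m < c.+1)%N.
  by rewrite !mulnn leq_exp2r // ltnS.
have a43 : (a < 43)%N.
  apply: sq; have : (a * a <= 42 * a)%N by lia.
  by case: (a) => // a'; rewrite leq_pmul2r // => ?; apply: leq_mul.
have b43 : (b < 43)%N by apply: sq; lia.
have := @search_pairs (fun a b =>
   let s := addN (mulN a a) (mulN b b) in
   ltN s (toN 52) || ~~ eqN
     (mulN (toN 12) (mulN (mulN a a) (mulN b b)))
     (mulN (addN s (toN 8)) (subN s (toN 4)))) 43 43
   a b isT a43 b43.
case/orP => [/BinNat.N.ltb_lt|/negP[]]; first by lia.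
apply/BinNat.N.eqb_eq.
have : (12 * (a * a * (b * b)) = (a * a + b * b + 8) * (a * a + b * b - 4))%N.
  rewrite Q (_ : a * a + b * b + 8 = 6 * (n - 2))%N; last lia.
  by rewrite (_ : a * a + b * b - 4 = 6 * (n - 4))%N; lia.
by lia.
Qed.

(** Here a and b stand for half the differences n - 2 u and n - 2 v, and h for
    n / 2.  The cutoff 35 expresses h < 7 and discards (a, b, h) = (4, 2, 6), which
    comes from the even-weight code of length 12. *)
Lemma five_weights_no_solution a b h : (7 <= h)%N -> (h <= 7 * a)%N ->
  (a * a + b * b + 10 = 5 * h)%N -> (4 * (a * a * (b * b)) + 55 * h = 15 * (h * h) + 46)%N -> False.
Proof.
move=> h7 ha S Q.
have sq m c : (m * m <= c * c)%N -> (m < c.+1)%N.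
  by rewrite !mulnn leq_exp2r // ltnS.
have a36 : (a < 36)%N.
  apply: sq; have : (a * a <= 35 * a)%N by lia.
  by case: (a) => // a'; rewrite leq_pmul2r // => ?; apply: leq_mul.
have b36 : (b < 36)%N by apply: sq; lia.
have := @search_pairs (fun a b =>
   let s := addN (addN (mulN a a) (mulN b b)) (toN 10) in
   ltN s (toN 35) || ~~ eqN
     (addN (mulN (toN 20) (mulN (mulN a a) (mulN b b)))
        (mulN (toN 55) s))
     (addN (mulN (toN 3) (mulN s s)) (toN 230))) 36 36
   a b isT a36 b36.
case/orP => [/BinNat.N.ltb_lt|/negP[]]; first by lia.
apply/BinNat.N.eqb_eq.
have : (20 * (a * a * (b * b)) + 55 * (a * a + b * b + 10) =
        3 * ((a * a + b * b + 10) * (a * a + b * b + 10)) + 230)%N.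
  by rewrite S; lia.
by lia.
Qed.

(** * Four and five weights *)

Lemma balance_pair n w (B : {set 'I_n}) : (2 * w < n)%N ->
  #|B| = w \/ #|B| = (n - w)%N -> balance B ^+ 2 = (n - 2 * w)%:R ^+ 2.
Proof.
move=> w2 [] Bw; rewrite /balance Bw !natrB ?natrM; try lia; ring.
Qed.

Lemma no_four_weights n D k (F : {set {set 'I_n}}) u v :
  strength F D -> set0 \in F -> setT \in F -> #|F| = (2 ^ k)%N ->
  (2 * u < n)%N -> (2 * v < n)%N ->
  (8 <= D)%N -> (12 <= n)%N ->
  (forall B, B \in F -> B != set0 -> B != setT ->
     [\/ #|B| = u, #|B| = (n - u)%N, #|B| = v | #|B| = (n - v)%N]) -> False.
Proof.
move=> sF F0 FT Fk u2 v2 D8 n12 FB; set a := (n - 2 * u)%N; set b := (n - 2 * v)%N.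
have [|B BF B0 BT|S Q E] := @lloyd_even n D F sF (a%:R ^+ 2 + b%:R ^+ 2)
  (a%:R ^+ 2 * b%:R ^+ 2) D8 _ F0 FT.
- by lia.
- have h : balance B ^+ 2 = a%:R ^+ 2 \/ balance B ^+ 2 = b%:R ^+ 2.
    by case: (FB B BF B0 BT) => h; [left|left|right|right];
       apply: balance_pair => //; by [left|right].
  have -> : balance B ^+ 4 = (balance B ^+ 2) ^+ 2 by ring.
  by case: h => ->; ring.
have na : n = (a + 2 * u)%N by rewrite /a; lia.
have nb : n = (b + 2 * v)%N by rewrite /b; lia.
clearbody a b.
have S' : (a * a + b * b + 20 = 6 * n)%N.
  by apply/eqP; rewrite -(eqr_nat rat) !natrD !natrM; apply/eqP; move: S; clear; lra.
have Q' : (a * a * (b * b) = 3 * (n - 2) * (n - 4))%N.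
  apply/eqP; rewrite -(eqr_nat rat) !natrM !natrB; [|lia|lia].
  by apply/eqP; move: Q; clear; lra.
have E' : (4 * (u * (n - u)) * (v * (n - v)) = 3 * 2 ^ k)%N.
  apply/eqP; rewrite -(eqr_nat rat) -Fk !natrM !natrB; [|lia|lia].
  have au : a%:R = n%:R - 2 * u%:R :> rat by rewrite na natrD natrM; ring.
  have bv : b%:R = n%:R - 2 * v%:R :> rat by rewrite nb natrD natrM; ring.
  by apply/eqP; move: E; rewrite au bv; clear; lra.
have /unbalanced_factors ratio : (u * (n - u) %| 3 * 2 ^ k)%N.
  by apply/dvdnP; exists (4 * (v * (n - v)))%N; rewrite -E' mulnAC.
apply: (@four_weights_no_solution a b n) => //; lia.
Qed.

(** The product of the five weights is 15 / 8 times a power of 2, so one of the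
    products u (n - u) and v (n - v) is prime to 5, and thus divides 3 * 2^k. *)
Lemma no_five_weights n D k (F : {set {set 'I_n}}) u v :
  strength F D -> set0 \in F -> setT \in F -> #|F| = (2 ^ k)%N ->
  (2 * u < n)%N -> (2 * v < n)%N ->
  (10 <= D)%N -> (14 <= n)%N -> ~~ odd n ->
  (forall B, B \in F -> B != set0 -> B != setT ->
     (2 * #|B|)%N = n \/ [\/ #|B| = u, #|B| = (n - u)%N, #|B| = v | #|B| = (n - v)%N]) -> False.
Proof.
move=> sF F0 FT Fk u2 v2 D10 n14 on FB; set a := (n - 2 * u)%N; set b := (n - 2 * v)%N.
have [|B BF B0 BT|S Q E] := @lloyd_odd n D F sF (a%:R ^+ 2 + b%:R ^+ 2)
  (a%:R ^+ 2 * b%:R ^+ 2) D10 _ F0 FT.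
- by lia.
- have h : balance B ^+ 2 = 0 \/
      (balance B ^+ 2 = a%:R ^+ 2 \/ balance B ^+ 2 = b%:R ^+ 2).
    case: (FB B BF B0 BT) => [h|h].
      have nB : n%:R = 2 * #|B|%:R :> rat by rewrite -natrM h.
      by left; rewrite /balance nB subrr expr0n.
    by right; case: h => h; [left|left|right|right];
       apply: balance_pair => //; by [left|right].
  have -> : balance B ^+ 4 = (balance B ^+ 2) ^+ 2 by ring.
  by case: h => [->|[]->]; ring.
have na : n = (a + 2 * u)%N by rewrite /a; lia.
have nb : n = (b + 2 * v)%N by rewrite /b; lia.
clearbody a b.
have [h nh] : exists h, n = (2 * h)%N by exists n./2; lia.
have [p ph] : exists p, h = (p + u)%N by exists (h - u)%N; lia.
have [q qh] : exists q, h = (q + v)%N by exists (h - v)%N; lia.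
have nhR : n%:R = 2 * h%:R :> rat by rewrite nh natrM.
have au : a%:R = 2 * p%:R :> rat by rewrite -natrM; congr _%:R; lia.
have bv : b%:R = 2 * q%:R :> rat by rewrite -natrM; congr _%:R; lia.
have uR : u%:R = h%:R - p%:R :> rat by rewrite ph natrD addrAC subrr add0r.
have vR : v%:R = h%:R - q%:R :> rat by rewrite qh natrD addrAC subrr add0r.
have S' : (p * p + q * q + 10 = 5 * h)%N.
  apply/eqP; rewrite -(eqr_nat rat) !natrD !natrM; apply/eqP.
  by move: S; rewrite au bv nhR; clear; lra.
have Q' : (4 * (p * p * (q * q)) + 55 * h = 15 * (h * h) + 46)%N.
  apply/eqP; rewrite -(eqr_nat rat) !natrD !natrM; apply/eqP.
  by move: Q; rewrite au bv nhR; clear; lra.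
have E' : (8 * h * (u * (n - u)) * (v * (n - v)) = 15 * 2 ^ k)%N.
  apply/eqP; rewrite -(eqr_nat rat) -Fk !natrM !natrB; [|lia|lia].
  by apply/eqP; move: E; rewrite au bv nhR uR vR; clear; lra.
clear S Q E au bv nhR uR vR.
have ratio w c : (2 * w < n)%N -> (c * (w * (n - w)) = 15 * 2 ^ k)%N ->
    ~~ (5 %| w * (n - w))%N -> (4 * w <= 3 * (n - w))%N.
  move=> w2 cw n5; apply: (@unbalanced_factors _ _ k); first by lia.
  have cop : coprime (w * (n - w)) 5 by rewrite coprime_sym prime_coprime.
  rewrite -(Gauss_dvdr _ cop); apply/dvdnP; exists c.
  by rewrite cw mulnA.
have ru := @ratio u (8 * h * (v * (n - v)))%N u2.
have rv := @ratio v (8 * h * (u * (n - u)))%N v2.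
rewrite -E' mulnAC in ru; rewrite -E' in rv.
have {ratio E'} d25 : (25 %| (u * (n - u)) * (v * (n - v)))%N -> False.
  move=> /(dvdn_mull (8 * h)); rewrite mulnA E' Gauss_dvdl //.
  exact: coprimeXr.
have [d5u|/(ru erefl) {}ru] := boolP (5 %| u * (n - u))%N; last first.
  by apply: (@five_weights_no_solution p q h) S' Q'; lia.
have [d5v|/(rv erefl) {}rv] := boolP (5 %| v * (n - v))%N; last first.
  by apply: (@five_weights_no_solution q p h); lia.
exact/d25/(dvdn_mul d5u d5v).
Qed.

Section HalfWeights.
Variables (n s : nat) (W : {set 'I_n.+1}).
Hypothesis W_rev : forall w, w \in W -> rev_ord w \in W.

(** Reversal exchanges the weights below and above n / 2. *)
Lemma half_weights :
  #|W| = (2 * #|[set w in W | (2 * w < n)%N]| + #|[set w in W | (2 * w == n)%N]|)%N.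
Proof.
rewrite -(cardsID [set w : 'I_n.+1 | (2 * w < n)%N] W) -setIdE.
rewrite -(cardsID [set w : 'I_n.+1 | (2 * w == n)%N] (W :\: _)).
rewrite mul2n -addnn -addnA; congr (_ + _)%N; rewrite addnC; congr (_ + _)%N.
  rewrite -[RHS](card_imset _ (@rev_ord_inj n.+1)); apply: eq_card => w.
  apply/idP/imsetP => [|[x]]; rewrite !inE /=.
    move=> /andP[h1 /andP[h2 h3]]; exists (rev_ord w); last by rewrite rev_ordK.
    by rewrite inE W_rev //=; have := ltn_ord w; lia.
  move=> /andP[xW x2] ->; rewrite W_rev //=; have := ltn_ord x; lia.
apply: eq_card => w; rewrite !inE; case: (w \in W); rewrite ?andbF //= ?andbT.
by apply/idP/idP; lia.
Qed.

Lemma two_half_weights : #|[set w in W | (2 * w < n)%N]| = 2%N ->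
  exists u v, [/\ (2 * u < n)%N, (2 * v < n)%N & forall w : 'I_n.+1, w \in W ->
    (2 * w)%N = n \/ [\/ w = u :> nat, w = (n - u)%N :> nat, w = v :> nat | w = (n - v)%N :> nat]].
Proof.
move=> /eqP/cards2P[u [v [_ uv]]]; exists u, v.
have hu : u \in [set w in W | (2 * w < n)%N] by rewrite uv !inE eqxx.
have hv : v \in [set w in W | (2 * w < n)%N] by rewrite uv !inE eqxx orbT.
move: hu hv; rewrite !inE => /andP[_ u2] /andP[_ v2]; split=> // w wW.
have half x : x \in W -> (2 * x < n)%N -> x = u \/ x = v.
  move=> xW x2; have : x \in [set w in W | (2 * w < n)%N] by rewrite inE xW.
  by rewrite uv !inE => /orP[/eqP|/eqP]; [left|right].
have [w2|w2|w2] := ltngtP (2 * w)%N n; last by left.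
  by right; case: (half w wW w2) => ->; [constructor 1|constructor 3].
have wn := ltn_ord w.
have [|e|e] := half (rev_ord w) (W_rev wW); first by rewrite /=; lia.
  by right; constructor 2; rewrite -e /=; lia.
by right; constructor 4; rewrite -e /=; lia.
Qed.

End HalfWeights.

(** * Words as sets *)

Definition symdiff (I : finType) (A B : {set I}) := [set i | (i \in A) (+) (i \in B)].

Section Supports.
Variable n : nat.
Implicit Types (A B : {set 'I_n}) (x y : 'rV['F_2]_n) (w : seq 'I_n).

Definition word B : 'rV['F_2]_n := \row_i (i \in B)%:R.
Definition suppset x : {set 'I_n} := [set i | x 0 i != 0].
Definition supports (C : {vspace 'rV['F_2]_n}) : {set {set 'I_n}} :=
  [set B | word B \in C].
Definition dot x y : 'F_2 := \sum_i x 0 i * y 0 i.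

Lemma F2_cases (a : 'F_2) : a = (a != 0)%:R.
Proof. by case: a => [[|[|m]]] //= lt_m; apply/val_inj. Qed.

Lemma suppsetK : cancel suppset word.
Proof. by move=> x; apply/rowP => i; rewrite !mxE inE -F2_cases. Qed.

Lemma wordK : cancel word suppset.
Proof. by move=> B; apply/setP => i; rewrite !inE !mxE; case: (i \in B). Qed.

Lemma wt_word B : wt (word B) = #|B|.
Proof. by rewrite -{2}(wordK B). Qed.

Lemma word_symdiff A B : word (symdiff A B) = word A + word B.
Proof.
apply/rowP => i; rewrite !mxE inE; case: (i \in A); case: (i \in B) => //=;
  exact/val_inj.
Qed.

Lemma word0 : word set0 = 0.
Proof. by apply/rowP => i; rewrite !mxE inE. Qed.

Lemma wordT : word setT = all_one n.
Proof. by apply/rowP => i; rewrite !mxE inE. Qed.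

Lemma symdiffK B : involutive (symdiff B).
Proof. by move=> A; apply/setP => i; rewrite !inE addbA addbb. Qed.

Lemma dot_word B y : dot (word B) y = \sum_(i in B) y 0 i.
Proof.
rewrite /dot [RHS]big_mkcond; apply: eq_bigr => i _; rewrite mxE.
by case: (i \in B); rewrite ?mul1r ?mul0r.
Qed.

Lemma natF2_eq0 m : (m%:R == 0 :> 'F_2) = ~~ odd m.
Proof. by rewrite -(dvdn_pcharf (pchar_Fp (isT : prime 2))) dvdn2. Qed.

Lemma character_symdiff w A B :
  character w (symdiff A B) = character w A * character w B.
Proof.
rewrite /character -big_split; apply: eq_bigr => i _ /=.
by rewrite /sgn inE signr_addb.
Qed.

(** The word whose inner product with B is the exponent of [character w B], modulo 2. *)
Definition parity_word w : 'rV['F_2]_n := \sum_(i <- w) word [set i].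

Lemma dot_parity_word x w : dot x (parity_word w) = \sum_(i <- w) x 0 i.
Proof.
rewrite /dot /parity_word; under eq_bigr do rewrite summxE mulr_sumr.
rewrite exchange_big; apply: eq_bigr => i _ /=.
rewrite (bigD1 i) //= mxE inE eqxx mulr1 big1 ?addr0 // => j ji.
by rewrite mxE inE (negbTE ji) mulr0.
Qed.

Lemma character_dot w B :
  character w B = (-1) ^+ (dot (word B) (parity_word w) != 0).
Proof.
have -> : character w B = (-1) ^+ (\sum_(i <- w) (i \in B))%N.
  by rewrite /character /sgn -expr_sum.
rewrite dot_parity_word -signr_odd.
have -> : \sum_(i <- w) word B 0 i = (\sum_(i <- w) (i \in B))%:R.
  by rewrite natr_sum; apply: eq_bigr => i _; rewrite mxE.
by rewrite natF2_eq0 negbK.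
Qed.

Lemma wt_parity_word w : (wt (parity_word w) <= size w)%N.
Proof.
apply: leq_trans (card_size w); apply: subset_leq_card; apply/subsetP => j.
rewrite inE /parity_word summxE => yj; apply: contraNT yj => jw.
rewrite big_seq big1 // => i iw; rewrite mxE inE.
by case: eqP => // ji; rewrite ji iw in jw.
Qed.

(** Translation by A permutes G and changes the sign of the sum. *)
Lemma sum_character_eq0 (G : {set {set 'I_n}}) w A :
  (forall B, (symdiff A B \in G) = (B \in G)) -> character w A = -1 ->
  \sum_(B in G) character w B = 0.
Proof.
move=> GA cA; have : \sum_(B in G) character w B = - \sum_(B in G) character w B.
  rewrite {1}(reindex_inj (inv_inj (symdiffK A))) -sumrN.
  apply: eq_big => [B|B _]; first exact: GA.
  by rewrite character_symdiff cA mulN1r.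
by move/eqP; rewrite -subr_eq0 opprK -mulr2n mulrn_eq0 => /eqP.
Qed.

Section Code.
Variables (C : {vspace 'rV['F_2]_n}).

Lemma supports_symdiff A B : A \in supports C -> (symdiff A B \in supports C) = (B \in supports C).
Proof.
rewrite !inE => AC; rewrite word_symdiff; apply/idP/idP => [h|]; last exact: memvD.
by rewrite -[word B](addKr (word A)) memvD ?memvN.
Qed.

Lemma supports0 : set0 \in supports C.
Proof. by rewrite inE word0 mem0v. Qed.

Lemma card_supports : #|supports C| = (2 ^ \dim C)%N.
Proof.
transitivity #|C|; last by rewrite (card_vspace C) card_Fp.
rewrite -(card_imset _ (can_inj wordK)); apply: eq_card => x.
apply/imsetP/idP => [[B]|xC]; first by rewrite inE => BC ->.
by exists (suppset x); rewrite ?inE suppsetK.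
Qed.

(** A character of weight below the dual distance is either trivial or given by a
    word outside the dual code; in the latter case some codeword has character
    value -1, and translating by it kills the sum both over the code and over
    the whole space. *)
Lemma strength_supports e : is_min_dist (dual_code C) e -> strength (supports C) e.-1.
Proof.
move=> [[y0 [_ y0n0 wy0]] emin] w we.
have e0 : (0 < e)%N.
  rewrite -wy0 card_gt0; apply: contraNneq y0n0 => y00.
  by apply/eqP/rowP => i; have := in_set0 i; rewrite -y00 inE mxE => /negbFE/eqP.
have [p0|pn0] := eqVneq (parity_word w) 0.
  have c1 B : character w B = 1.
    rewrite character_dot p0 /dot big1 ?eqxx // => i _; by rewrite [X in _ * X]mxE mulr0.
  rewrite /mean !(eq_bigr _ (fun B _ => c1 B)) !sumr_const.
  have -> : #|[pred B : {set 'I_n} | true]| = (2 ^ n)%N.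
    transitivity #|powerset [set: 'I_n]|; first by rewrite powersetT cardsT; apply: eq_card.
    by rewrite card_powerset cardsT card_ord.
  by rewrite mulfV ?mulr1 // pnatr_eq0 expn_eq0.
have [x xC xp] : exists2 x, x \in C & dot x (parity_word w) != 0.
  have : parity_word w \notin dual_code C.
    apply: contraTN (wt_parity_word w) => /emin/(_ pn0); lia.
  move/mem_dual_code => h.
  have /forall_inPn[x xC xp] : ~~ [forall x in C, dot x (parity_word w) == 0].
    by apply/negP => /forall_inP h'; apply: h => x xC; apply/eqP/h'.
  by exists x.
have cx : character w (suppset x) = -1 by rewrite character_dot suppsetK xp expr1.
have xF : suppset x \in supports C by rewrite inE suppsetK.
rewrite /mean (sum_character_eq0 _ cx) => [|B]; last exact: supports_symdiff.
have <- : \sum_(B in [set: {set 'I_n}]) character w B = \sum_B character w B.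
  by apply: eq_bigl => B; rewrite inE.
by rewrite (sum_character_eq0 _ cx) ?mul0r ?mulr0 // => B; rewrite !inE.
Qed.

End Code.
End Supports.

(** * Weights under the AM-condition *)

Definition low_weights n (C : {vspace 'rV['F_2]_n}) t : {set 'I_n.+1} :=
  [set u : 'I_n.+1 | (words_of_weight C u != set0) && (0 < u <= n - t)%N].

Lemma words_of_weightP n (C : {vspace 'rV['F_2]_n}) u :
  reflect (exists2 B, B \in supports C & #|B| = u) (words_of_weight C u != set0).
Proof.
apply: (iffP (set0Pn _)) => [[x]|[B BC Bu]].
  rewrite inE => /andP[xC /eqP wx]; exists (suppset x) => //.
  by rewrite inE suppsetK.
by exists (word B); rewrite inE wt_word Bu eqxx andbT; rewrite inE in BC.
Qed.

Lemma min_dist_uniq n (C : {vspace 'rV['F_2]_n}) d d' :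
  is_min_dist C d -> is_min_dist C d' -> d = d'.
Proof.
move=> [[x [xC x0 <-]] dmin] [[y [yC y0 <-]] d'min].
by apply/eqP; rewrite eqn_leq dmin ?d'min.
Qed.

Lemma dual_dist_even n (C : {vspace 'rV['F_2]_n}) e :
  all_one n \in C -> is_min_dist (dual_code C) e -> ~~ odd e.
Proof.
move=> C1 [[y [/mem_dual_code yC _ <-]] _]; rewrite -natF2_eq0 -(yC _ C1).
have := dot_word [set: 'I_n] y; rewrite /dot wordT => ->.
rewrite (eq_bigr (fun i => ((y 0 i != 0) : nat)%:R)) => [|i _]; last exact: F2_cases.
rewrite -natr_sum /wt -sum1_card; apply/eqP; congr _%:R.
rewrite big_mkcond [RHS]big_mkcond /=.
by apply: eq_bigr => i _; rewrite !inE; case: (_ != _).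
Qed.

Lemma card_ltSn n (B : {set 'I_n}) : (#|B| < n.+1)%N.
Proof. by rewrite ltnS -[X in (_ <= X)%N]card_ord max_card. Qed.

Section LowWeights.
Variables (n e t s : nat) (C : {vspace 'rV['F_2]_n}).
Hypotheses (C1 : all_one n \in C) (Ce : is_min_dist (dual_code C) e).
Hypotheses (t0 : (0 < t)%N) (s0 : (0 < s)%N) (ets : e = (t + s)%N).
Hypothesis (Ws : #|low_weights C t| = s).

Lemma supportsC B : B \in supports C -> ~: B \in supports C.
Proof.
have T1 : setT \in supports C by rewrite inE wordT.
have -> : ~: B = symdiff [set: 'I_n] B.
  by apply/setP => i; rewrite !inE; case: (i \in B).
by rewrite supports_symdiff.
Qed.

(** If u < t then all u-sets are words, so a dual word y of minimum weight is
    constant, that is all-one, and dperp = n.  Now n - t = s, so all of 1, ..., s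
    are weights; but y is not orthogonal to a word of weight 1. *)
Lemma low_weights_ge u : u \in low_weights C t -> (t <= u)%N.
Proof.
move=> uW; rewrite leqNgt; apply/negP => ut.
have := uW; rewrite inE => /andP[/words_of_weightP uB /andP[u0 un]].
have utn : (u + t <= n)%N by lia.
pose Wseq := [seq val w | w <- enum (low_weights C t)].
have sW : size Wseq = s by rewrite size_map -cardE Ws.
have memW w : w \in Wseq -> exists2 w' : 'I_n.+1, w' \in low_weights C t & w = w'.
  by case/mapP => w'; rewrite mem_enum; exists w'.
have all_u (Y : {set 'I_n}) : #|Y| = u -> Y \in supports C.
  apply: (@all_blocks n _ t Wseq u) => //.
  - by rewrite sW -ets; exact: strength_supports.
  - exact: supports0.
  - by apply/negP => /memW[w']; rewrite inE => /andP[_ /andP[+ _]] => /[swap] <-.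
  - by rewrite map_inj_uniq ?enum_uniq //; exact: val_inj.
  - move=> B BF B0 Bt; have Bn := card_ltSn B.
    have Bnt : (#|B| <= n - t)%N by lia.
    apply/mapP; exists (Ordinal Bn) => //; rewrite mem_enum inE /=.
    apply/andP; split; first by apply/words_of_weightP; exists B.
    by rewrite card_gt0 B0.
  - by apply/mapP; exists u; rewrite ?mem_enum.
  - exact: ltnW.
have [[y [/mem_dual_code yC y0 wy]] _] := Ce.
have dotB (B : {set 'I_n}) : B \in supports C -> \sum_(i in B) y 0 i = 0.
  by rewrite inE => /yC; rewrite -dot_word.
(* Two u-sets differing by exchanging i and j are both orthogonal to y. *)
have y_const i j : y 0 i = y 0 j.
  have [->//|ij] := eqVneq i j.
  have : (0 < #|[set A : {set 'I_n} | A \subset ~: [set i; j] & #|A| == u.-1]|)%N.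
    have c2 : #|~: [set i; j]| = (n - 2)%N by rewrite cardsCs setCK cards2 ij card_ord.
    have u2 : (u.-1 <= n - 2)%N by lia.
    by rewrite cards_draws bin_gt0 c2.
  case/card_gt0P => A; rewrite inE => /andP[/subsetP Aij /eqP Au].
  have iA : i \notin A by apply/negP => /Aij; rewrite !inE eqxx.
  have jA : j \notin A by apply/negP => /Aij; rewrite !inE eqxx orbT.
  have sumA k : k \notin A -> y 0 k + \sum_(i in A) y 0 i = 0.
    move=> kA; rewrite -big_setU1 //; apply/dotB/all_u.
    by rewrite cardsU1 kA Au; lia.
  by apply: (addIr (\sum_(i in A) y 0 i)); rewrite !sumA.
have y1 i : y 0 i != 0.
  apply: contraNneq y0 => yi; apply/eqP/rowP => j.
  by rewrite (y_const j i) yi mxE.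
have en : e = n.
  by rewrite -wy -{2}(card_ord n) -cardsT; apply: eq_card => i; rewrite !inE y1.
(* Otherwise the s weights would lie between 2 and n - t = s. *)
have W1 : 1%N \in Wseq.
  apply: contraT => W1; have : (size Wseq <= size (iota 2 s.-1))%N.
    apply: uniq_leq_size => [|w wW].
      by rewrite map_inj_uniq ?enum_uniq //; exact: val_inj.
    have [w'] := memW _ wW; rewrite inE => /andP[_ /andP[w0 wn]] ww'.
    rewrite mem_iota; have : w <> 1%N by move=> w1; rewrite -w1 wW in W1.
    by lia.
  by rewrite sW size_iota; lia.
have [w] := memW _ W1; rewrite inE => /andP[/words_of_weightP[B BC Bw] _] w1.
have /eqP/cards1P[i Bi] : #|B| = 1%N by rewrite Bw.
by have := dotB B BC; rewrite Bi big_set1 => yi; move: (y1 i); rewrite yi eqxx.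
Qed.

Lemma low_weights_length : (2 * t <= n)%N.
Proof.
have /card_gt0P[u uW] : (0 < #|low_weights C t|)%N by rewrite Ws.
have := low_weights_ge uW; move: uW; rewrite inE => /andP[_ /andP[_]].
lia.
Qed.

(** Weights in (n - t, n) do not exist: their complements would be weights below
    t. *)
Lemma low_weightsP (w : 'I_n.+1) :
  reflect ([/\ 0 < w, w < n & exists2 B, B \in supports C & #|B| = w])%N (w \in low_weights C t).
Proof.
rewrite inE; apply: (iffP andP) => [[/words_of_weightP h /andP[h1 h2]]|[w0 wn [B BC Bw]]].
  split=> //; lia.
split; first by apply/words_of_weightP; exists B.
rewrite w0 leqNgt; apply/negP => wt.
have Bc : #|~: B| = (n - w)%N by have := cardsC B; rewrite card_ord Bw; lia.
have := low_weights_length => tn.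
have nw : (n - w < n.+1)%N by lia.
have : Ordinal nw \in low_weights C t.
  rewrite inE; apply/andP; split; last by rewrite /=; lia.
  by apply/words_of_weightP; exists (~: B); first exact: supportsC.
by move/low_weights_ge => /=; lia.
Qed.

Lemma low_weights_rev w : w \in low_weights C t -> rev_ord w \in low_weights C t.
Proof.
case/low_weightsP => w0 wn [B BC Bw]; apply/low_weightsP; split => /=; try lia.
have Bc : #|~: B| = (n - w)%N by have := cardsC B; rewrite card_ord Bw; lia.
by exists (~: B); [exact: supportsC | rewrite Bc ?subSS].
Qed.

(** If t >= s + 2, the strength dperp - 1 is at least 2 s + 1, which exceeds the
    degree 8 or 10 of the Lloyd equations, and n >= 2 t excludes the short
    even-weight codes. *)
Lemma AM_offset_bound : s = 4%N \/ s = 5%N -> (t <= s.+1)%N.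
Proof.
move=> s45; rewrite leqNgt; apply/negP => ts.
have tn := low_weights_length.
have sF := strength_supports Ce.
have FT : setT \in supports C by rewrite -setC0 supportsC ?supports0.
have half := half_weights low_weights_rev.
have mid : (#|[set w in low_weights C t | (2 * w == n)%N]| <= 1)%N.
  apply/card_le1_eqP => x y; rewrite !inE => /andP[_ /eqP xn] /andP[_ /eqP yn].
  by apply/val_inj => /=; lia.
have [|u [v [u2 v2 W]]] := two_half_weights low_weights_rev; first by lia.
have Fuv (B : {set 'I_n}) : B \in supports C -> B != set0 -> B != setT -> (2 * #|B|)%N = n \/
    [\/ #|B| = u, #|B| = (n - u)%N, #|B| = v | #|B| = (n - v)%N].
  move=> BC B0 BT; have Bn := card_ltSn B.
  apply: (W (Ordinal Bn)); apply/low_weightsP; split; last by exists B.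
    by rewrite card_gt0.
  rewrite ltn_neqAle -ltnS Bn andbT; apply: contra BT => /= /eqP Bn'.
  by rewrite eqEcard subsetT cardsT card_ord Bn' /=.
case: s45 => s_val.
  apply: (no_four_weights sF (supports0 C) FT (card_supports C) u2 v2); try lia.
  move=> B BC B0 BT; case: (Fuv B BC B0 BT) => // B2.
  exfalso; suff : (0 < #|[set w in low_weights C t | (2 * w == n)%N]|)%N by lia.
  have Bn := card_ltSn B.
  apply/card_gt0P; exists (Ordinal Bn); rewrite inE /= B2 eqxx andbT.
  have B1 : (0 < #|B|)%N by rewrite card_gt0.
  have Bltn : (#|B| < n)%N by lia.
  by apply/low_weightsP; split; [exact: B1 | exact: Bltn | exists B].
apply: (no_five_weights sF (supports0 C) FT (card_supports C) u2 v2 _ _ _ Fuv); try lia.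
have /card_gt0P[w] : (0 < #|[set w in low_weights C t | (2 * w == n)%N]|)%N by lia.
by rewrite inE => /andP[_ /eqP <-]; lia.
Qed.

End LowWeights.

Theorem theorem1p1 (n k d dperp t : nat) (C : {vspace 'rV['F_2]_n})
    (hC : is_code k d C) (h1 : all_one n \in C)
    (hdperp : is_min_dist (dual_code C) dperp) (ht : (0 < t)%N) :
  (AM_condition C t -> dperp%:Z - t%:Z = 4%:Z ->
     (dperp, t) = (6%N, 2%N) \/ (dperp, t) = (8%N, 4%N)) /\
  (AM_condition C t -> dperp%:Z - t%:Z = 5%:Z ->
     [\/ (dperp, t) = (6%N, 1%N), (dperp, t) = (8%N, 3%N)
       | (dperp, t) = (10%N, 5%N)]).
Proof.
have ev := dual_dist_even h1 hdperp.
have bound s : (0 < s)%N -> s = 4%N \/ s = 5%N -> AM_condition C t -> dperp%:Z - t%:Z = s%:Z ->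
    dperp = (t + s)%N /\ (t <= s.+1)%N.
  move=> s0 s45 [e [Ce eW]] ds.
  have ed := min_dist_uniq Ce hdperp; rewrite {}ed in eW.
  have dts : dperp = (t + s)%N by lia.
  split=> //; apply: (AM_offset_bound h1 hdperp ht s0 dts _ s45).
  have : s%:Z = #|low_weights C t|%:Z by rewrite -ds eW.
  by case.
split=> AM ds.
  have [//|//|dts ts] := bound 4%N _ _ AM ds; first by left.
  rewrite {}dts oddD in ev *.
  by case: t ht ts ev {AM ds bound hdperp} => [|[|[|[|[|[|?]]]]]] //=; [left|right].
have [//|//|dts ts] := bound 5%N _ _ AM ds; first by right.
rewrite {}dts oddD in ev *.
by case: t ht ts ev {AM ds bound hdperp} => [|[|[|[|[|[|[|?]]]]]]] //=;
  [constructor 1|constructor 2|constructor 3].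
Qed.
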